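(* Let $c$ be continuous and satisfy (C1)–(C3). Let $0\le\overline h\in L^\infty(\mathbb{R}^d\times\mathbb{R}^d)$ have compact support and let $0\le f,g\in L^1_c(\mathbb{R}^d)$ with $\Gamma(f,g)^{\overline h}\ne\emptyset$. Then $I_c$ has at most one minimizer on $\Gamma(f,g)^{\overline h}$ (as an element of $L^1(\mathbb{R}^d\times\mathbb{R}^d)$); combined with existence, the minimizer is unique.
   Context: Cost assumptions: (C1) $c$ is bounded; (C2) there is a Lebesgue-negligible closed set $Z\subset\mathbb{R}^d\times\mathbb{R}^d$ with $c\in C^2((\mathbb{R}^d\times\mathbb{R}^d)\setminus Z)$; (C3) $\det D^2_{xy}c(x,y)\ne0$ for all $(x,y)\notin Z$, where $D^2_{xy}c=(\partial^2c/\partial x_i\partial y_j)_{i,j}$. $L^1_c$: integrable functions with compact support. $\Gamma(f,g)$: the $0\le h\in L^1_c(\mathbb{R}^d\times\mathbb{R}^d)$ with $\int h(x,y)dy=f(x)$ and $\int h(x,y)dx=g(y)$ a.e.; $\Gamma(f,g)^{\overline h}:=\{h\in\Gamma(f,g):h\le\overline h\text{ a.e.}\}$. $I_c(h):=\int c\,h\,dx\,dy$. *)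

(* Defs.v *)
From HB Require Import structures.
From mathcomp Require Import all_boot all_order all_algebra.
From mathcomp Require Import all_classical all_reals all_analysis.
Set Implicit Arguments. Unset Strict Implicit. Unset Printing Implicit Defensive.
Import Order.TTheory GRing.Theory Num.Theory.
Import numFieldNormedType.Exports.
Local Open Scope classical_set_scope.
Local Open Scope ring_scope.

(* R^d is modelled as row vectors 'rV[R]_d (with their matrix topology).
   We equip 'rV[R]_d with the product (= Borel) sigma-algebra generated by the
   coordinate maps, exactly as the library does for n.-tuple R. *)
Section rV_measurable.
Context (R : realType) (d : nat).

Definition rV_coord : 'I_d -> 'rV[R]_d -> R := fun i x => x ord0 i.

Lemma rV_set0 : g_sigma_preimage rV_coord set0.
Proof. exact: sigma_algebra0. Qed.

Lemma rV_setC (A : set 'rV[R]_d) :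
  g_sigma_preimage rV_coord A -> g_sigma_preimage rV_coord (~` A).
Proof. exact: sigma_algebraC. Qed.

Lemma rV_bigcup (F : (set 'rV[R]_d)^nat) :
  (forall i, g_sigma_preimage rV_coord (F i)) ->
  g_sigma_preimage rV_coord (\bigcup_i (F i)).
Proof. exact: sigma_algebra_bigcup. Qed.

HB.instance Definition _ := @isMeasurable.Build default_measure_display
  'rV[R]_d (g_sigma_preimage rV_coord) rV_set0 rV_setC rV_bigcup.
End rV_measurable.

(* mu is (the Borel restriction of) Lebesgue measure on R^d: the measure of
   every half-open box [a,b) is the product of its side lengths. *)
Definition is_lebesgue_rV (R : realType) (d : nat)
    (mu : set 'rV[R]_d -> \bar R) : Prop :=
  forall a b : 'rV[R]_d, (forall i, a ord0 i <= b ord0 i) ->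
    mu [set x | forall i, a ord0 i <= x ord0 i < b ord0 i] =
    (\prod_(i < d) (b ord0 i - a ord0 i))%:E.

Definition dirx (R : realType) (d : nat) (k : 'I_d) : 'rV[R]_d * 'rV[R]_d :=
  (delta_mx ord0 k, 0).
Definition diry (R : realType) (d : nat) (k : 'I_d) : 'rV[R]_d * 'rV[R]_d :=
  (0, delta_mx ord0 k).

Definition coord_dirs (R : realType) (d : nat) : set ('rV[R]_d * 'rV[R]_d) :=
  [set v | exists k, v = @dirx R d k \/ v = @diry R d k].

Definition shift (R : realType) (d : nat) (z : 'rV[R]_d * 'rV[R]_d) (t : R)
    (v : 'rV[R]_d * 'rV[R]_d) : 'rV[R]_d * 'rV[R]_d :=
  (z.1 + t *: v.1, z.2 + t *: v.2).

Definition pdiff (R : realType) (d : nat) (f : 'rV[R]_d * 'rV[R]_d -> R)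
    (v : 'rV[R]_d * 'rV[R]_d) (z : 'rV[R]_d * 'rV[R]_d) : R :=
  derive1 (fun t : R => f (shift z t v)) 0.

Definition C2_on (R : realType) (d : nat) (U : set ('rV[R]_d * 'rV[R]_d))
    (f : 'rV[R]_d * 'rV[R]_d -> R) : Prop :=
  forall z, U z -> forall v w, @coord_dirs R d v -> @coord_dirs R d w ->
    [/\ derivable (fun t : R => f (shift z t v)) 0 1,
        derivable (fun t : R => pdiff f v (shift z t w)) 0 1,
        {for z, continuous f},
        {for z, continuous (pdiff f v)} &
        {for z, continuous (pdiff (pdiff f v) w)}].

Definition Dxy (R : realType) (d : nat) (c : 'rV[R]_d * 'rV[R]_d -> R)
    (z : 'rV[R]_d * 'rV[R]_d) : 'M[R]_d :=
  \matrix_(i < d, j < d) pdiff (pdiff c (@diry R d j)) (@dirx R d i) z.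

Local Open Scope ereal_scope.

Definition L1c_d (R : realType) (d : nat) (mu : {measure set 'rV[R]_d -> \bar R})
    (f : 'rV[R]_d -> R) : Prop :=
  mu.-integrable setT (EFin \o f) /\
  exists K : set 'rV[R]_d, compact K /\ {ae mu, forall x, ~ K x -> f x = 0%R}.

Definition L1c_dd (R : realType) (d : nat)
    (mu : {sigma_finite_measure set 'rV[R]_d -> \bar R})
    (h : 'rV[R]_d * 'rV[R]_d -> R) : Prop :=
  (mu \x mu).-integrable setT (EFin \o h) /\
  exists K : set ('rV[R]_d * 'rV[R]_d),
    compact K /\ {ae mu \x mu, forall z, ~ K z -> h z = 0%R}.

Definition Gamma (R : realType) (d : nat)
    (mu : {sigma_finite_measure set 'rV[R]_d -> \bar R})
    (f g : 'rV[R]_d -> R) (h : 'rV[R]_d * 'rV[R]_d -> R) : Prop :=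
  [/\ L1c_dd mu h,
      {ae mu \x mu, forall z, (0 <= h z)%R},
      {ae mu, forall x, \int[mu]_y (h (x, y))%:E = (f x)%:E} &
      {ae mu, forall y, \int[mu]_x (h (x, y))%:E = (g y)%:E}].

Definition Gamma_bar (R : realType) (d : nat)
    (mu : {sigma_finite_measure set 'rV[R]_d -> \bar R})
    (f g : 'rV[R]_d -> R) (hbar h : 'rV[R]_d * 'rV[R]_d -> R) : Prop :=
  Gamma mu f g h /\ {ae mu \x mu, forall z, (h z <= hbar z)%R}.

Definition Ic (R : realType) (d : nat)
    (mu : {sigma_finite_measure set 'rV[R]_d -> \bar R})
    (c h : 'rV[R]_d * 'rV[R]_d -> R) : \bar R :=
  \int[mu \x mu]_z (c z * h z)%:E.

Definition is_minimizer (R : realType) (d : nat)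
    (mu : {sigma_finite_measure set 'rV[R]_d -> \bar R})
    (c : 'rV[R]_d * 'rV[R]_d -> R) (S : set ('rV[R]_d * 'rV[R]_d -> R))
    (h : 'rV[R]_d * 'rV[R]_d -> R) : Prop :=
  S h /\ forall h', S h' -> Ic mu c h <= Ic mu c h'.

(* Main.v *)
(** Suppose two minimizers [h1], [h2] differ on a set of positive measure.  Since
    [D^2_xy c] is invertible off [Z], some entry [d^2 c / dx_i dy_j] has a constant
    sign on a box [B] disjoint from [Z] on which [|h1 - h2| >= delta] with positive
    measure; call [E] that part of [B].  Infinitely many translates of [E] of equal
    mass cannot be almost disjoint inside a bounded set, so for some [t, r > 0] there
    is a set [S] of positive measure such that all four corners [z], [z + t e_i],
    [z + r e'_j], [z + t e_i + r e'_j] lie in [E] for every [z] in [S].  The signed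
    sum of the indicators of the four corresponding translates of [S] has zero
    marginals, and a small multiple of it can be added, with either sign, to
    [(h1 + h2) / 2] without violating [0 <= h <= hbar].  Its cost is the integral over
    [S] of the mixed second difference of [c], which by the mean value theorem has the
    sign of [d^2 c / dx_i dy_j]: a suitable multiple strictly decreases the cost.

    Dimension [0], where the determinant hypothesis is void, is treated apart: a
    density on the one-point space is determined by its marginal. *)
Require Import Defs.
From HB Require Import structures.
From mathcomp Require Import all_boot all_order all_algebra.
From mathcomp Require Import all_classical all_reals all_analysis.
From mathcomp Require Import measurable_realfun ring lra.
Import Order.TTheory GRing.Theory Num.Theory.
Import numFieldNormedType.Exports.
Local Open Scope classical_set_scope.
Local Open Scope ring_scope.

(** * Half-open boxes as generators of the sigma-algebra on row vectors *)

Section RowVectorBoxes.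
Context {R : realType} {d : nat}.
Implicit Types (a b x y v : 'rV[R]_d).

Definition rVbox a b : set 'rV[R]_d :=
  [set x | forall i, a ord0 i <= x ord0 i < b ord0 i].

(** The order condition is part of the family because [is_lebesgue_rV] gives the volume of ordered
    boxes only. *)
Definition rVboxes : set (set 'rV[R]_d) :=
  [set A | exists a b, (forall i, a ord0 i <= b ord0 i) /\ A = rVbox a b].

Lemma measurable_rV_coord (i : 'I_d) :
  measurable_fun setT (@rV_coord R d i).
Proof.
move=> _ Y mY; rewrite setTI; apply: sub_sigma_algebra => /=.
rewrite -bigcup_seq/=; exists i => /=; first by rewrite mem_index_enum.
by exists Y => //; rewrite setTI.
Qed.

Lemma measurable_fun_rVP d' (T : measurableType d') (f : T -> 'rV[R]_d) :
  (forall i, measurable_fun setT (fun t : T => f t ord0 i)) ->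
  measurable_fun setT f.
Proof.
move=> mf _ Y; rewrite setTI.
suff : @measurable _ 'rV[R]_d `<=` [set Y | measurable (f @^-1` Y)] by apply.
apply: smallest_sub.
  split=> /=; first by rewrite preimage_set0.
  - by move=> A mA; rewrite setTD preimage_setC; exact: measurableC.
  - by move=> F mF; rewrite preimage_bigcup; exact: bigcup_measurable.
move=> A; rewrite -bigcup_seq/= => -[i _ [B mB <-]].
by have := mf i measurableT _ mB; rewrite !setTI.
Qed.

Lemma rVboxE a b : rVbox a b =
  \bigcap_(i in [set: 'I_d]) (@rV_coord R d i @^-1` `[a ord0 i, b ord0 i[%classic).
Proof.
apply/seteqP; split=> x /=.
  by move=> xab i _; rewrite /= in_itv /=; exact: xab.
by move=> xab i; have := xab i I; rewrite /= in_itv.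
Qed.

Lemma measurable_rVbox a b : measurable (rVbox a b).
Proof.
rewrite rVboxE; apply: fin_bigcap_measurable => //.
move=> i _; rewrite -[X in measurable X]setTI.
exact: measurable_rV_coord.
Qed.

Lemma rVboxes_setI : setI_closed rVboxes.
Proof.
move=> _ _ [a [b [ab ->]]] [a' [b' [ab' ->]]].
pose a2 := \row_i Num.max (a ord0 i) (a' ord0 i).
(* The maximum with [a2] keeps the corners ordered when the two boxes are disjoint; the box is then
   empty, as the intersection is. *)
pose b2 := \row_i Num.max (a2 ord0 i) (Num.min (b ord0 i) (b' ord0 i)).
exists a2, b2; split; first by move=> i; rewrite [leRHS]mxE le_max lexx.
apply/seteqP; split=> x /=.
  move=> [xab xab'] i; have /andP[h1 h2] := xab i; have /andP[h3 h4] := xab' i.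
  by rewrite mxE ge_max h1 h3 mxE lt_max lt_min h2 h4 orbT.
move=> xab; split => i; have := xab i; rewrite [b2 _ _]mxE lt_max => /andP[+ /orP[h|]].
- by rewrite leNgt h.
- by rewrite mxE ge_max lt_min => /andP[-> _] /andP[->].
- by rewrite leNgt h.
- by rewrite mxE ge_max lt_min => /andP[_ ->] /andP[_ ->].
Qed.

Definition rVcube (n : nat) := rVbox (const_mx (- n%:R)) (const_mx n%:R).

Lemma rVcube_rVboxes n : rVboxes (rVcube n).
Proof.
exists (const_mx (- n%:R)), (const_mx n%:R); split => // i.
by rewrite !mxE -subr_ge0 opprK addr_ge0.
Qed.

Lemma rVcube_eventually x : \forall n \near \oo, rVcube n x.
Proof.
near=> n; move=> i; rewrite !mxE -lerNl.
have xn : forall j, `|x ord0 j| < n%:R.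
  near: n.
  apply: filter_forall => j.
  near=> n; apply: (@lt_le_trans _ _ (Num.bound `|x ord0 j|)%:R).
    by apply: archi_boundP.
  rewrite ler_nat; near: n; exact: nbhs_infty_ge.
by have := xn i; rewrite ltr_norml => /andP[h1 ->]; rewrite lerNl ltW.
Unshelve. all: by end_near. Qed.

Lemma bigcup_rVcube : \bigcup_n rVcube n = setT.
Proof.
apply/seteqP; split => // x _.
have [n _ xn] := rVcube_eventually x.
by exists n => //; apply: xn => /=.
Qed.

Lemma measurable_rVboxes :
  @measurable _ 'rV[R]_d = <<s rVboxes >>.
Proof.
apply/seteqP; split; last first.
  apply: smallest_sub; first exact: sigma_algebra_measurable.
  by move=> _ [a [b [_ ->]]]; exact: measurable_rVbox.
apply: smallest_sub; first exact: smallest_sigma_algebra.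
move=> A; rewrite -bigcup_seq/= => -[i _ [B mB <-]].
suff mi : measurable_fun setT
    (@rV_coord R d i : g_sigma_algebraType rVboxes -> R).
  exact: (mi measurableT _ mB).
apply: (measurability (@RGenCInfty.G R)); first exact: RGenCInfty.measurableE.
move=> _ [_ [r ->]] <-; rewrite setTI.
(* A half-space is exhausted by boxes. The minimum with [n] keeps each box ordered and adds no
   points: [n <= x_i] is incompatible with the upper bound [x_i < n]. *)
have -> : @rV_coord R d i @^-1` `[r, +oo[ =
    \bigcup_n rVbox (\row_j (if j == i then Num.min r n%:R else - n%:R)) (const_mx n%:R).
  apply/seteqP; split => x; rewrite /= in_itv /= andbT.
    move=> rx.
    have [n _ xn] := rVcube_eventually x.
    exists n => // j; have := xn n (leqnn n) j; rewrite !mxE.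
    by case: eqP => [->|//] /andP[_ ->]; rewrite ge_min [X in X || _]rx.
  case=> n _ /(_ i); rewrite !mxE eqxx ge_min => /andP[/orP[//|h1 h2]].
  by move: h1; rewrite leNgt h2.
apply: bigcupT_measurable => n; apply: sub_sigma_algebra.
eexists; eexists; split; last reflexivity.
move=> j; rewrite !mxE; case: eqP => _; first by rewrite ge_min lexx orbT.
by rewrite -subr_ge0 opprK addr_ge0.
Qed.

Lemma measurable_addr_rV v : measurable_fun setT (fun x : 'rV[R]_d => x + v).
Proof.
apply: measurable_fun_rVP => i.
rewrite (_ : (fun _ => _) = fun x : 'rV[R]_d => rV_coord i x + v ord0 i); last first.
  by apply/funext => x; rewrite mxE.
by apply: measurable_funD => //; exact: measurable_rV_coord.
Qed.

End RowVectorBoxes.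

(** * Translation invariance of Lebesgue measure and of its product with itself *)

Section TranslationInvariance.
Local Open Scope ereal_scope.
Context {R : realType} {d : nat} (mu : {sigma_finite_measure set 'rV[R]_d -> \bar R}).
Hypothesis mu_leb : is_lebesgue_rV mu.

Lemma lebesgue_rV_box_lty (a b : 'rV[R]_d) : mu (rVbox a b) < +oo.
Proof.
(* The corners may be unordered here, so the box is first enlarged to an ordered one, whose volume
   is known. *)
have sub : rVbox a b `<=` rVbox a (\row_i Num.max (a ord0 i) (b ord0 i)).
  move=> x xab i; have /andP[-> h] := xab i.
  by rewrite mxE lt_max h orbT.
apply: le_lt_trans (le_measure _ _ _ sub) _; try (by rewrite inE; exact: measurable_rVbox).
by rewrite [X in X < _]mu_leb ?ltry// => i; rewrite mxE le_max lexx.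
Qed.

(** A translated box keeps its side lengths, so [mu] and its pushforward agree on a generating
    family closed under intersection; the cubes exhaust the space with finite mass, and uniqueness
    of measures applies. *)
Lemma lebesgue_rV_translate (v : 'rV[R]_d) (A : set 'rV[R]_d) :
  measurable A -> mu ((fun x => (x + v)%R) @^-1` A) = mu A.
Proof.
move=> mA.
have mf := measurable_addr_rV v.
rewrite -[LHS]/(pushforward mu (fun x => (x + v)%R) A).
apply: (measure_unique rVboxes (@rVcube R d) measurable_rVboxes rVboxes_setI
  _ bigcup_rVcube _ _ _ _ _ mA).
- exact: rVcube_rVboxes.
- move=> _ [a [b [ab ->]]].
  rewrite -[LHS]/(mu ((fun x => (x + v)%R) @^-1` rVbox a b)).
  rewrite (_ : _ @^-1` _ = rVbox (a - v) (b - v)%R); last first.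
    by apply/seteqP; split => x xab i; have := xab i; rewrite !mxE lerBlDr ltrBrDr.
  rewrite [LHS]mu_leb; last by move=> i; rewrite !mxE lerB.
  rewrite [RHS]mu_leb//; congr EFin; apply: eq_bigr => i _; rewrite !mxE; ring.
- move=> k; rewrite -[X in X < _]/(mu ((fun x => (x + v)%R) @^-1` rVcube k)).
  rewrite (_ : _ @^-1` _ = rVbox (const_mx (- k%:R) - v)%R (const_mx k%:R - v)%R).
    exact: lebesgue_rV_box_lty.
  by apply/seteqP; split => x xab i; have := xab i; rewrite !mxE lerBlDr ltrBrDr.
Qed.

Let P := mu \x mu.

Lemma measurable_addr_rV2 (v : 'rV[R]_d * 'rV[R]_d) :
  measurable_fun setT (fun z : 'rV[R]_d * 'rV[R]_d => (z + v)%R).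
Proof.
apply: measurable_fun_pair.
  by apply: measurableT_comp (measurable_addr_rV _) _.
by apply: measurableT_comp (measurable_addr_rV _) _.
Qed.

(** A translation acts separately on the two factors, so the pushforward agrees with the product
    measure on rectangles, which determine it. *)
Lemma lebesgue_rV2_translate v (A : set ('rV[R]_d * 'rV[R]_d)) :
  measurable A -> P ((fun z => (z + v)%R) @^-1` A) = P A.
Proof.
move=> mA; have mf := measurable_addr_rV2 v.
rewrite -[LHS]/(pushforward P (fun z => (z + v)%R) A).
apply/esym; apply: product_measure_unique => //.
move=> B C mB mC.
rewrite -[LHS]/(P ((fun z => (z + v)%R) @^-1` (B `*` C))).
rewrite (_ : _ @^-1` _ = ((fun x => (x + v.1)%R) @^-1` B) `*`
  ((fun x => (x + v.2)%R) @^-1` C)); last by [].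
have mtr v' D : measurable D -> measurable ((fun x : 'rV[R]_d => (x + v')%R) @^-1` D).
  by move=> mD; rewrite -[X in measurable X]setTI; exact: measurable_addr_rV.
rewrite [LHS]product_measure1E; [|exact: mtr|exact: mtr].
by congr (_ * _); exact: lebesgue_rV_translate.
Qed.

End TranslationInvariance.

(** * Mean value theorems along coordinate lines *)

Section SmoothAlongLines.
Context {R : realType} {d : nat}.
Implicit Types (F c : 'rV[R]_d * 'rV[R]_d -> R) (z u v : 'rV[R]_d * 'rV[R]_d).

(** [pdiff] and [C2_on] always differentiate at 0 along a line recentred at the point considered.
    Undoing the recentring gives the derivative of one function of a real variable at an arbitrary
    parameter, as the mean value theorem requires. *)
Lemma derivable_translate (f : R -> R) (a : R) :
  derivable (fun s => f (a + s)) 0 1 -> derivable f a 1.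
Proof.
rewrite /derivable /=.
under [X in cvg (X @ _)]eq_fun do rewrite !addr0 (addrC a) ?[_%:A]mulr1.
by under [X in _ -> cvg (X @ _)]eq_fun do rewrite ?[_%:A]mulr1.
Qed.

Lemma derive1_translate (f : R -> R) (a : R) :
  derive1 (fun s => f (a + s)) 0 = derive1 f a.
Proof.
rewrite /derive1 /=.
by under [X in lim (X @ _)]eq_fun do rewrite !addr0 (addrC a) ?[_%:A]mulr1.
Qed.

Lemma shift_shift z v (a s : R) : Defs.shift (Defs.shift z a v) s v = Defs.shift z (a + s) v.
Proof. by rewrite /Defs.shift /= -!addrA -!scalerDl. Qed.

Lemma shift_swap z u v (a s : R) :
  Defs.shift (Defs.shift z a u) s v = Defs.shift (Defs.shift z s v) a u.
Proof. by rewrite /Defs.shift /= !(addrAC _ (a *: _)). Qed.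

Lemma MVT_shift F z v (t : R) : 0 < t ->
  (forall s : R, 0 <= s <= t ->
    derivable (fun r : R => F (Defs.shift (Defs.shift z s v) r v)) 0 1) ->
  exists2 s, 0 <= s <= t & F (Defs.shift z t v) - F z = pdiff F v (Defs.shift z s v) * t.
Proof.
move=> t0 dF; pose f s := F (Defs.shift z s v).
have fE s : (fun r : R => F (Defs.shift (Defs.shift z s v) r v)) = fun r => f (s + r).
  by apply/funext => r; rewrite shift_shift.
have df (s : R) : 0 <= s <= t -> derivable f s 1.
  by move=> /dF; rewrite fE; exact: derivable_translate.
have [||s sI E] := @MVT R f (derive1 f) 0 t t0.
- move=> s; rewrite in_itv /= => /andP[s0 st].
  by rewrite derive1E; apply/derivableP/df; rewrite !ltW.
- apply: derivable_within_continuous => s; rewrite in_itv /= => h; exact: df.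
exists s; first by move: sI; rewrite in_itv /= => /andP[/ltW -> /ltW ->].
rewrite /pdiff fE derive1_translate -[t in RHS]subr0 -E /f; congr (_ - F _).
by rewrite /Defs.shift !scale0r !addr0; case: z {dF f fE df E}.
Qed.

(* Two successive applications of the mean value theorem: first in [v] for the
   increment [c (z + t u) - c z], then in [u] for the derivative of [c] in [v]. *)
Lemma mixed_difference_MVT c u v (U : set ('rV[R]_d * 'rV[R]_d)) z (t r : R) :
  C2_on U c -> @coord_dirs R d u -> @coord_dirs R d v -> 0 < t -> 0 < r ->
  (forall a b : R, 0 <= a <= t -> 0 <= b <= r -> U (Defs.shift (Defs.shift z a u) b v)) ->
  exists a b : R, [/\ 0 <= a <= t, 0 <= b <= r &
    c (Defs.shift (Defs.shift z t u) r v) - c (Defs.shift z t u) - c (Defs.shift z r v) + c z =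
    pdiff (pdiff c v) u (Defs.shift (Defs.shift z a u) b v) * t * r].
Proof.
move=> cC2 cu cv t0 r0 UU.
have U2 (a b : R) : 0 <= a <= t -> 0 <= b <= r -> U (Defs.shift (Defs.shift z b v) a u).
  by move=> *; rewrite shift_swap; exact: UU.
have t0t : 0 <= t <= t by apply/andP; split => //; exact: ltW.
have s0t : 0 <= (0 : R) <= t by apply/andP; split => //; exact: ltW.
have shift0 (w w' : 'rV[R]_d * 'rV[R]_d) : Defs.shift w 0 w' = w.
  by rewrite /Defs.shift !scale0r !addr0; case: w.
have dc w : U w -> derivable (fun s : R => c (Defs.shift w s v)) 0 1.
  by move=> Uw; have [] := cC2 _ Uw v v cv cv.
pose F w := c (Defs.shift w t u) - c w.
have FE w : (fun s : R => F (Defs.shift w s v)) =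
    (fun s => c (Defs.shift (Defs.shift w t u) s v)) - (fun s => c (Defs.shift w s v)).
  by apply/funext => s; rewrite /F shift_swap.
have dF (b : R) : 0 <= b <= r ->
    derivable (fun s : R => F (Defs.shift (Defs.shift z b v) s v)) 0 1.
  move=> br; rewrite FE; apply: derivableB; apply: dc; first exact: U2.
  by rewrite -[X in U X](shift0 _ u); exact: U2.
have [b br Eb] := MVT_shift F z v r r0 dF.
have [a at_ Ea] := MVT_shift (pdiff c v) (Defs.shift z b v) u t t0
  (fun a ha => let: And5 _ h _ _ _ := cC2 _ (U2 a b ha br) v u cv cu in h).
exists a, b; split => //.
rewrite (shift_swap z u v a b) -Ea.
have -> : c (Defs.shift (Defs.shift z t u) r v) - c (Defs.shift z t u) - c (Defs.shift z r v) + c z =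
    F (Defs.shift z r v) - F z by rewrite /F shift_swap; ring.
rewrite Eb; congr (_ * _).
rewrite {1}/pdiff FE derive1E deriveB; [|apply: dc; exact: U2|].
  by rewrite -!derive1E.
by apply: dc; rewrite -[X in U X](shift0 _ u); exact: U2.
Qed.

End SmoothAlongLines.

(** * A countable base of rational cubes *)

Section RationalCubes.
Context {R : realType} {d : nat}.

(** A cube with rational centre and half-side [1/(n+1)]: the index type is countable, and the cubes
    are boxes in the sense of [rVbox]. *)
Definition ratcube (k : 'rV[rat]_d * nat) : set 'rV[R]_d :=
  rVbox (map_mx ratr k.1 - const_mx k.2.+1%:R^-1)
        (map_mx ratr k.1 + const_mx k.2.+1%:R^-1).

Lemma ratcube_nbhs (x : 'rV[R]_d) (U : set 'rV[R]_d) : nbhs x U ->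
  exists k, ratcube k x /\ ratcube k `<=` U.
Proof.
move=> /nbhs_ballP[e /= e0 xeU].
(* This gives [1/(n+1) < e/2]: two points of a cube, each within [1/(n+1)] of the centre, are then
   less than [e] apart in every coordinate. *)
pose n := Num.bound (2 / e).
have ne : n.+1%:R^-1 < e / 2.
  rewrite -[ltRHS]invrK ltf_pV2 ?posrE ?invr_gt0 ?divr_gt0//.
  rewrite invf_div; apply: lt_le_trans (archi_boundP _) _; first by rewrite divr_ge0 ?ltW.
  by rewrite ler_nat.
have n0 : 0 < n.+1%:R^-1 :> R by rewrite invr_gt0.
have q_ i : {q : rat | `|x ord0 i - ratr q| < n.+1%:R^-1 :> R}.
  apply: cid; have [|q] := @rat_in_itvoo R (x ord0 i - n.+1%:R^-1) (x ord0 i + n.+1%:R^-1).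
    by rewrite ltrBlDr -addrA ltrDl addr_gt0.
  rewrite in_itv /= => /andP[h1 h2]; exists q.
  by rewrite distrC ltr_distl h1.
exists (\row_i sval (q_ i), n); split=> [i|y yQ].
  rewrite !mxE /=; case: (q_ i) => q /=; rewrite ltr_distl => /andP[/ltW -> ->//].
apply: xeU; split => // i j; have -> : i = ord0 by exact: ord1.
have := yQ j; rewrite !mxE /=.
case: (q_ j) => q /=; rewrite /ball /= !ltr_distl => /andP[h1 h2] /andP[h3 h4].
set r := n.+1%:R^-1 in ne h1 h2 h3 h4; apply/andP; split; move: ne h1 h2 h3 h4; move: (ratr q) (x _ _) (y _ _) => a b c *; lra.
Qed.

Definition ratcube2 (k : ('rV[rat]_d * nat) * ('rV[rat]_d * nat)) :
  set ('rV[R]_d * 'rV[R]_d) := ratcube k.1 `*` ratcube k.2.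

Lemma measurable_ratcube2 k : measurable (ratcube2 k).
Proof. by apply: measurableX; exact: measurable_rVbox. Qed.

Lemma ratcube2_nbhs z (U : set ('rV[R]_d * 'rV[R]_d)) : nbhs z U ->
  exists k, ratcube2 k z /\ ratcube2 k `<=` U.
Proof.
case: z => x y [[A B] [/= /ratcube_nbhs[k [kx kA]] /ratcube_nbhs[l [ly lB]]] ABU].
exists (k, l); split => // -[x' y'] [/= x'k y'l]; apply: ABU; split => /=.
  exact: kA.
exact: lB.
Qed.

(** An open set is the union of the rational cubes that it contains, and there are countably many of
    them. *)
Lemma open_measurable_rV2 (U : set ('rV[R]_d * 'rV[R]_d)) : open U -> measurable U.
Proof.
move=> oU.
have -> : U = \bigcup_k (if `[< ratcube2 k `<=` U >] then ratcube2 k else set0).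
  apply/seteqP; split => z.
    move=> Uz; have [|k [kz kU]] := ratcube2_nbhs z U.
      by rewrite openE in oU; exact: oU.
    by exists k => //; rewrite asboolT.
  by move=> [k _]; case: asboolP => // kU /kU.
apply: countable_bigcupT_measurable => // k.
by case: asboolP => // _; exact: measurable_ratcube2.
Qed.

Lemma continuous_measurable_rV2 (c : 'rV[R]_d * 'rV[R]_d -> R) :
  continuous c -> measurable_fun setT c.
Proof.
move=> cc; apply: (measurability (@RGenOInfty.G R)); first exact: RGenOInfty.measurableE.
move=> _ [_ [r ->]] <-; rewrite setTI; apply: open_measurable_rV2.
apply: open_comp; first by move=> z _; exact: cc.
exact: interval_open.
Qed.

End RationalCubes.

(** * Overlap, invariance and positivity for abstract measures *)

Section MeasureTools.
Local Open Scope ereal_scope.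
Context {R : realType} {d} {T : measurableType d} (P : {measure set T -> \bar R}).

Lemma negligible_bigcup_countType (K : countType) (F : K -> set T) :
  (forall k, P.-negligible (F k)) -> P.-negligible (\bigcup_k F k).
Proof.
move=> F0.
have -> : \bigcup_k F k =
    \bigcup_n (if @unpickle K n is Some k then F k else set0).
  apply/seteqP; split => z.
    by move=> [k _ Fk]; exists (pickle k); rewrite ?pickleK.
  by move=> [n _]; case: unpickle => // k Fk; exists k.
apply: negligible_bigcup => n; case: unpickle => // ; exact: negligible_set0.
Qed.

(** If all pairwise intersections were null, the first [n] sets would have a union of mass [n p]
    inside [C], for every [n]. *)
Lemma overlap_of_bounded_mass (A : (set T)^nat) (C : set T) (p : \bar R) :
  0 < p -> (forall k, measurable (A k)) -> (forall k, P (A k) = p) ->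
  measurable C -> (forall k, A k `<=` C) -> P C < +oo ->
  exists k n, (k < n)%N /\ 0 < P (A k `&` A n).
Proof.
move=> p0 mA PA mC AC PC.
have [//|no] := pselect (exists k n, (k < n)%N /\ 0 < P (A k `&` A n)).
have null k n : (k < n)%N -> P (A k `&` A n) = 0.
  move=> kn; apply/eqP; rewrite eq_le measure_ge0 andbT leNgt; apply/negP => h.
  by apply: no; exists k, n.
pose U n := \bigcup_(k in `I_n) A k.
have mU n : measurable (U n) by apply: bigcup_measurable => k _; exact: mA.
have UA n : P (A n `&` U n) = 0.
  apply/negligibleP; first exact: measurableI.
  apply: (@negligibleS _ _ _ _ (\bigcup_k if (k < n)%N then A k `&` A n else set0)).
    by move=> z [Anz [k /= kn Akz]]; exists k => //; rewrite kn.
  apply: negligible_bigcup => k; case: ifPn => kn; last exact: negligible_set0.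
  by apply/negligibleP; [exact: measurableI|exact: null].
have PU n : P (U n) = n%:R%:E * p.
  elim: n => [|n IH]; first by rewrite /U II0 bigcup_set0 measure0 mul0e.
  have -> : U n.+1 = U n `|` (A n `\` U n).
    by rewrite /U IIS bigcup_setU bigcup_set1 setUDr setDv setD0.
  rewrite measureU//; [|exact: measurableD|by rewrite setDE setICA setICr setI0].
  have DE : P (A n `\` U n) = p by rewrite -(PA n) (measureDI P (mA n) (mU n)) [X in _ + X](UA n) adde0.
  rewrite [LHS](_ : _ = n%:R%:E * p + p); last by congr (_ + _).
  by rewrite -natr1 EFinD ge0_muleDl ?lee_fin// mul1e.
have Cn n : n%:R%:E * p <= P C.
  rewrite -PU; apply: le_measure; rewrite ?inE//.
  by move=> z [k _]; exact: AC.
(* The case [n = 1] shows that [p] is finite; the contradiction is then reached in the reals with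
   some [n > P C / p]. *)
have pC : p <= P C by have := Cn 1%N; rewrite mul1e.
have Cfin : P C \is a fin_num by rewrite ge0_fin_numE.
have pfin : p \is a fin_num by rewrite ge0_fin_numE ?(ltW p0)// (le_lt_trans pC).
move: p0 pC Cn; rewrite -(fineK Cfin) -(fineK pfin).
move: (fine p) (fine (P C)) => r s; rewrite lte_fin lee_fin => r0 rs.
move=> /(_ (Num.bound (s / r))).
rewrite -EFinM lee_fin -ler_pdivlMr// leNgt archi_boundP// divr_ge0 ?ltW//.
exact: lt_le_trans r0 rs.
Qed.

Lemma integrable_invariant (th : T -> T) (f : T -> \bar R) :
  measurable_fun setT th ->
  (forall A, measurable A -> P (th @^-1` A) = P A) ->
  P.-integrable setT f -> P.-integrable setT (f \o th).
Proof.
move=> mth inv intf; have mf := measurable_int P intf.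
apply/integrableP; split; first exact: measurableT_comp.
move/integrableP : intf => [_].
rewrite (_ : \int[P]_x `|f x| = \int[P]_x `|(f \o th) x|)//.
rewrite -[RHS](@ge0_integral_pushforward _ _ _ _ _ th mth P setT (abse \o f))//=.
- by apply: eq_measure_integral => A mA _; rewrite /= -inv.
- exact: measurableT_comp.
Qed.

Lemma integral_invariant (th : T -> T) (f : T -> \bar R) :
  measurable_fun setT th ->
  (forall A, measurable A -> P (th @^-1` A) = P A) ->
  P.-integrable setT f -> \int[P]_x f (th x) = \int[P]_x f x.
Proof.
move=> mth inv intf; have mf := measurable_int P intf.
rewrite -[LHS](@integral_pushforward _ _ _ _ _ th mth P setT f)//=.
- by apply: eq_measure_integral => A mA _; rewrite /= -inv.
- exact: integrable_invariant.
Qed.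

Lemma integral_gt0 (f : T -> R) (S : set T) :
  measurable S -> 0 < P S -> P.-integrable setT (EFin \o f) ->
  (forall x, 0 <= f x)%R -> (forall x, S x -> 0 < f x)%R ->
  0 < \int[P]_x (f x)%:E.
Proof.
move=> mS PS intf f0 fS.
rewrite lt_neqAle integral_ge0 ?andbT; last by move=> x _; rewrite lee_fin.
apply/negP => /eqP/esym E.
have mf := measurable_int P intf.
have /(ae_eq_integral_abs P measurableT mf) : \int[P]_x `|(EFin \o f) x| = 0.
  by rewrite -[RHS]E; apply: eq_integral => x _; rewrite /= ger0_norm.
move=> ae0; suff : P S = 0 by move=> S0; rewrite S0 ltxx in PS.
apply/negligibleP => //.
apply: negligibleS ae0 => x Sx /= /(_ Logic.I) [] h.
by have := fS x Sx; rewrite h ltxx.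
Qed.

End MeasureTools.

(** * Integrability and linearity for the combinations used below *)

Section IntegrableTools.
Local Open Scope ereal_scope.
Context {R : realType} {d} {T : measurableType d} (P : {measure set T -> \bar R}).

Lemma integrable_indic_lty (A : set T) : measurable A -> P A < +oo ->
  P.-integrable setT (EFin \o (\1_A : T -> R)).
Proof.
move=> mA PA; apply/integrableP; split; first exact/measurable_EFinP.
rewrite (eq_integral (fun x => (\1_A x)%:E)); last first.
  by move=> t _; rewrite /= ger0_norm.
by rewrite integral_indic// setIT.
Qed.

Lemma integrable_bounded_mul (c f : T -> R) (M : R) :
  measurable_fun setT c -> (forall x, `|c x| <= M)%R ->
  P.-integrable setT (EFin \o f) ->
  P.-integrable setT (EFin \o (fun x => c x * f x)%R).
Proof.
move=> mc cM intf.
have /= := integrableMr measurableT mc _ intf; apply.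
by exists M; split => [|y My x _ /=]; [exact: num_real|exact: le_trans (cM x) (ltW My)].
Qed.

Lemma integrable_mixed4 (f1 f2 f3 f4 : T -> R) :
  P.-integrable setT (EFin \o f1) -> P.-integrable setT (EFin \o f2) ->
  P.-integrable setT (EFin \o f3) -> P.-integrable setT (EFin \o f4) ->
  P.-integrable setT (EFin \o (fun x => f1 x - f2 x - f3 x + f4 x)%R).
Proof.
move=> i1 i2 i3 i4.
exact: (integrableD measurableT (integrableB measurableT (integrableB measurableT i1 i2) i3) i4).
Qed.

Lemma integral_mixed4 (f1 f2 f3 f4 : T -> R) :
  P.-integrable setT (EFin \o f1) -> P.-integrable setT (EFin \o f2) ->
  P.-integrable setT (EFin \o f3) -> P.-integrable setT (EFin \o f4) ->
  \int[P]_x (f1 x - f2 x - f3 x + f4 x)%:E =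
  \int[P]_x (f1 x)%:E - \int[P]_x (f2 x)%:E - \int[P]_x (f3 x)%:E + \int[P]_x (f4 x)%:E.
Proof.
move=> i1 i2 i3 i4.
have i12 := integrableB measurableT i1 i2.
have i123 := integrableB measurableT i12 i3.
rewrite -(integralB measurableT i1 i2) -(integralB measurableT i12 i3).
by rewrite -(integralD measurableT i123 i4).
Qed.

(** The common form of the two marginals and of the cost of a perturbed midpoint of two
    densities. *)
Lemma integral_midpoint_perturb (p q r : T -> R) (k : R) :
  P.-integrable setT (EFin \o p) -> P.-integrable setT (EFin \o q) ->
  P.-integrable setT (EFin \o r) ->
  \int[P]_x (2^-1 * (p x + q x) + k * r x)%:E =
  2^-1%:E * (\int[P]_x (p x)%:E + \int[P]_x (q x)%:E) + k%:E * \int[P]_x (r x)%:E.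
Proof.
move=> ip iq ir.
have ipq := integrableD measurableT ip iq.
have i2 := integrableZl measurableT 2^-1%R ipq.
have i3 := integrableZl measurableT k ir.
rewrite -(integralD measurableT ip iq) -(integralZl measurableT ipq).
by rewrite -(integralZl measurableT ir) -(integralD measurableT i2 i3).
Qed.

Lemma integrable_midpoint_perturb (p q r : T -> R) (k : R) :
  P.-integrable setT (EFin \o p) -> P.-integrable setT (EFin \o q) ->
  P.-integrable setT (EFin \o r) ->
  P.-integrable setT (EFin \o (fun x => 2^-1 * (p x + q x) + k * r x)%R).
Proof.
move=> ip iq ir.
have ipq := integrableD measurableT ip iq.
have i2 := integrableZl measurableT 2^-1%R ipq.
have i3 := integrableZl measurableT k ir.
exact: (integrableD measurableT i2 i3).
Qed.

End IntegrableTools.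

(** * Overlap of a bounded set with its translates *)

Section MixedDifference.
Local Open Scope ereal_scope.
Context {R : realType} {d : nat} (mu : {sigma_finite_measure set 'rV[R]_d -> \bar R}).
Hypothesis mu_leb : is_lebesgue_rV mu.
Let P := mu \x mu.
Let X := ('rV[R]_d * 'rV[R]_d)%type.

Lemma product_rVbox_lty (a b a' b' : 'rV[R]_d) :
  P (rVbox a b `*` rVbox a' b') < +oo.
Proof.
have mB (x y : 'rV[R]_d) := measurable_rVbox x y.
rewrite /P product_measure1E//.
by rewrite lte_mul_pinfty// ?ge0_fin_numE//; exact: lebesgue_rV_box_lty.
Qed.

(* The translates of [E] by [u / (k + 1)] have equal mass and lie in a common
   bounded set, so two of them overlap. *)
Lemma translate_overlap (E : set X) (u : X) (a b a' b' : 'rV[R]_d) :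
  measurable E -> 0 < P E -> E `<=` rVbox a b `*` rVbox a' b' ->
  exists t : R, (0 < t)%R /\ 0 < P (E `&` (fun z => z + t *: u)%R @^-1` E).
Proof.
move=> mE PE EB.
pose T_ (v : X) := (fun z : X => z + v)%R @^-1` E.
have mtr v : measurable_fun setT (fun z : X => z + v)%R := measurable_addr_rV2 v.
have mT v A : measurable A -> measurable ((fun z : X => z + v)%R @^-1` A).
  by move=> mA; rewrite -[X in measurable X]setTI; exact: mtr.
pose w (k : nat) : X := (- (k.+1%:R^-1 *: u))%R.
pose n (x : 'rV[R]_d) : 'rV[R]_d := map_mx Num.norm x.
pose C : set X := (rVbox (a - n u.1) (b + n u.1) `*` rVbox (a' - n u.2) (b' + n u.2))%R.
have mC : measurable C by apply: measurableX; exact: measurable_rVbox.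
have box1 (k : nat) (x y x0 v : 'rV[R]_d) :
    rVbox x y (x0 - k.+1%:R^-1 *: v)%R -> rVbox (x - n v)%R (y + n v)%R x0.
  move=> h i; have := h i; rewrite !mxE.
  have : (`|k.+1%:R^-1 * v ord0 i| <= `|v ord0 i|)%R.
    rewrite normrM ler_piMl// ger0_norm ?invr_ge0//.
    by rewrite invf_le1 ?ltr0n// ler1n.
  rewrite ler_norml; move: (_ * _)%R `|_|%R => p q /andP[h1 h2] /andP[h3 h4].
  by apply/andP; split; lra.
have TC k : T_ (w k) `<=` C.
  by move=> z /EB [h1 h2]; split; apply: (box1 k).
have [k [l [kl]]] := overlap_of_bounded_mass P (fun k => T_ (w k)) C (P E) PE
  (fun k => mT (w k) E mE) (fun k => lebesgue_rV2_translate mu mu_leb (w k) E mE)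
  mC TC (product_rVbox_lty _ _ _ _).
move=> kl0.
pose t : R := (k.+1%:R^-1 - l.+1%:R^-1)%R.
exists t; split.
  by rewrite subr_gt0 ltf_pV2 ?posrE// ltr_nat ltnS.
suff <- : P (T_ (w k) `&` T_ (w l)) = P (E `&` (fun z => z + t *: u)%R @^-1` E) by [].
(* Seen from [z + w k], the point [z + w l] is displaced by [t *: u]; translating by [w k] thus
   turns the overlap of the two translates into that of [E] with its preimage. *)
rewrite -[RHS](lebesgue_rV2_translate mu mu_leb (w k)); last first.
  exact: (measurableI _ _ mE (mT (t *: u)%R _ mE)).
have e z : (z + w k + t *: u = z + w l)%R.
  by rewrite /w /t scalerBl -!addrA; congr (_ + _)%R; rewrite addrA addNr add0r.
congr P; apply/seteqP; split => z [h1 h2]; split => //; move: h2.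
  by rewrite /= e.
by rewrite /= e.
Qed.

End MixedDifference.

(** * The rectangular perturbation: its marginals and its cost *)

Section Perturbation.
Local Open Scope ereal_scope.
Context {R : realType} {d : nat} (mu : {sigma_finite_measure set 'rV[R]_d -> \bar R}).
Hypothesis mu_leb : is_lebesgue_rV mu.
Let P := mu \x mu.
Let X := ('rV[R]_d * 'rV[R]_d)%type.

(** Since [\1_S (z - w)] is the indicator of [S + w], this is the alternating sum over the four
    corners [S], [S + u], [S + v], [S + u + v]. *)
Definition mixed_indic (S : set X) (u v z : X) : R :=
  (\1_S z - \1_S (z - u) - \1_S (z - v) + \1_S (z - u - v))%R.

Lemma mixed_indic_abs_le4 (S : set X) (u v z : X) : (`|mixed_indic S u v z| <= 4)%R.
Proof.
rewrite /mixed_indic !indicE.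
case: (_ \in S); case: (_ \in S); case: (_ \in S); case: (_ \in S) => /=;
  rewrite ler_norml; apply/andP; split; lra.
Qed.

Lemma mixed_indic_support (S : set X) (u v z : X) : mixed_indic S u v z != 0%R ->
  [\/ S z, S (z - u)%R, S (z - v)%R | S (z - u - v)%R].
Proof.
rewrite /mixed_indic !indicE.
have [/set_mem|_] := boolP (z \in S); first by constructor 1.
have [/set_mem|_] := boolP (_ \in S); first by constructor 2.
have [/set_mem|_] := boolP (_ \in S); first by constructor 3.
have [/set_mem|_] := boolP (_ \in S); first by constructor 4.
by rewrite /= !subr0 addr0 eqxx.
Qed.

Let lty S a b a' b' : measurable S -> S `<=` rVbox a b `*` rVbox a' b' -> P S < +oo.
Proof.
move=> mS SB; apply: (@le_lt_trans _ _ (P (rVbox a b `*` rVbox a' b'))).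
  apply: le_measure => //; rewrite inE//.
  by apply: measurableX; exact: measurable_rVbox.
exact: product_rVbox_lty.
Qed.

Section FixedSet.
Variables (S : set X) (a b a' b' : 'rV[R]_d).
Hypotheses (mS : measurable S) (SB : S `<=` rVbox a b `*` rVbox a' b').

Let mtr (w : X) : measurable_fun setT (fun z : X => z - w)%R := measurable_addr_rV2 (- w)%R.

Let inv (w : X) (A : set X) : measurable A -> P ((fun z => z - w)%R @^-1` A) = P A.
Proof. exact: lebesgue_rV2_translate. Qed.

Let int1S : P.-integrable setT (EFin \o (\1_S : X -> R)).
Proof. by apply: integrable_indic_lty => //; exact: lty SB. Qed.

Let int1 (w : X) : P.-integrable setT (EFin \o (fun z : X => \1_S (z - w)%R : R)).
Proof. exact: (integrable_invariant P _ _ (mtr w) (inv w) int1S). Qed.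

Lemma integrable_mixed_indic u v : P.-integrable setT (EFin \o mixed_indic S u v).
Proof.
have := integrable_mixed4 P _ _ _ _ int1S (int1 u) (int1 v) (int1 (u + v)%R).
congr (integrable _ _ (_ \o _)); apply/funext => z.
by rewrite /mixed_indic opprD addrA.
Qed.

Let invmu (w : 'rV[R]_d) (A : set 'rV[R]_d) : measurable A ->
  mu ((fun y => y - w)%R @^-1` A) = mu A.
Proof. exact: lebesgue_rV_translate. Qed.

Let mtrmu (w : 'rV[R]_d) : measurable_fun setT (fun y : 'rV[R]_d => y - w)%R :=
  measurable_addr_rV (- w)%R.

(** Every section of [S] lies in a box of finite mass. Hence the marginals of the perturbation can
    be computed at every point, not just almost everywhere. *)
Let int_x (x : 'rV[R]_d) : mu.-integrable setT (EFin \o (fun y => \1_S (x, y) : R)).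
Proof.
rewrite (_ : (fun y => _) = \1_(xsection S x)); last first.
  by apply/funext => y; rewrite !indicE mem_xsection.
apply: integrable_indic_lty; first exact: measurable_xsection.
apply: (@le_lt_trans _ _ (mu (rVbox a' b'))); last exact: lebesgue_rV_box_lty.
apply: le_measure; rewrite ?inE; [exact: measurable_xsection|exact: measurable_rVbox|].
by move=> y; rewrite /xsection /= inE => /SB [].
Qed.

Let int_y (y : 'rV[R]_d) : mu.-integrable setT (EFin \o (fun x => \1_S (x, y) : R)).
Proof.
rewrite (_ : (fun x => _) = \1_(ysection S y)); last first.
  by apply/funext => x; rewrite !indicE mem_ysection.
apply: integrable_indic_lty; first exact: measurable_ysection.
apply: (@le_lt_trans _ _ (mu (rVbox a b))); last exact: lebesgue_rV_box_lty.
apply: le_measure; rewrite ?inE; [exact: measurable_ysection|exact: measurable_rVbox|].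
by move=> x; rewrite /ysection /= inE => /SB [].
Qed.

(** Integration in [y] does not see the shift by [e'], so the terms cancel in pairs of opposite
    sign; finiteness of the integrals makes the cancellation legitimate. *)
Lemma integral_mixed_indic_y (e e' x : 'rV[R]_d) :
  \int[mu]_y (mixed_indic S (e, 0) (0, e') (x, y))%:E = 0.
Proof.
pose i x' := fun y => \1_S (x', y) : R.
have iinv x' : \int[mu]_y (i x' (y - e'))%:E = \int[mu]_y (i x' y)%:E.
  exact: (integral_invariant mu _ _ (mtrmu e') (invmu e') (int_x x')).
have iint x' : mu.-integrable setT (EFin \o (fun y => i x' (y - e')))%R.
  exact: (integrable_invariant mu _ _ (mtrmu e') (invmu e') (int_x x')).
rewrite (_ : (fun y => _) = (fun y => (i x y - i (x - e) y - i x (y - e') + i (x - e) (y - e'))%:E)%R).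
  rewrite (integral_mixed4 mu) ?iinv; [|exact: int_x|exact: int_x|exact: iint|exact: iint].
  have fin x' := integrable_fin_num measurableT (int_x x').
  rewrite -(fineK (fin x)) -(fineK (fin (x - e)%R)).
  by rewrite -!EFinB -EFinD; congr EFin; rewrite /fine; ring.
apply/funext => y; rewrite /mixed_indic /i; congr (_%:E).
rewrite (_ : (x, y) - (e, 0) = (x - e, y))%R; last by congr pair; rewrite subr0.
rewrite (_ : (x, y) - (0, e') = (x, y - e'))%R; last by congr pair; rewrite subr0.
by rewrite (_ : (x - e, y) - (0, e') = (x - e, y - e'))%R//; congr pair; rewrite subr0.
Qed.

Lemma integral_mixed_indic_x (e e' y : 'rV[R]_d) :
  \int[mu]_x (mixed_indic S (e, 0) (0, e') (x, y))%:E = 0.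
Proof.
pose i y' := fun x => \1_S (x, y') : R.
have iinv y' : \int[mu]_x (i y' (x - e))%:E = \int[mu]_x (i y' x)%:E.
  exact: (integral_invariant mu _ _ (mtrmu e) (invmu e) (int_y y')).
have iint y' : mu.-integrable setT (EFin \o (fun x => i y' (x - e)))%R.
  exact: (integrable_invariant mu _ _ (mtrmu e) (invmu e) (int_y y')).
rewrite (_ : (fun x => _) = (fun x => (i y x - i y (x - e) - i (y - e') x + i (y - e') (x - e))%:E)%R).
  rewrite (integral_mixed4 mu) ?iinv; [|exact: int_y|exact: iint|exact: int_y|exact: iint].
  have fin y' := integrable_fin_num measurableT (int_y y').
  rewrite -(fineK (fin y)) -(fineK (fin (y - e')%R)).
  by rewrite -!EFinB -EFinD; congr EFin; rewrite /fine; ring.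
apply/funext => x; rewrite /mixed_indic /i; congr (_%:E).
rewrite (_ : (x, y) - (e, 0) = (x - e, y))%R; last by congr pair; rewrite subr0.
rewrite (_ : (x, y) - (0, e') = (x, y - e'))%R; last by congr pair; rewrite subr0.
by rewrite (_ : (x - e, y) - (0, e') = (x - e, y - e'))%R//; congr pair; rewrite subr0.
Qed.

Variables (c : X -> R) (M : R).
Hypotheses (mc : measurable_fun setT c) (cM : forall z, (`|c z| <= M)%R).

Let mixed_difference u v z := (c z - c (z + u) - c (z + v) + c (z + u + v))%R.

Let intc (w : X) : P.-integrable setT (EFin \o (fun z : X => c z * \1_S (z - w))%R).
Proof. exact: (integrable_bounded_mul P _ _ _ mc cM (int1 w)). Qed.

Let mtr' (w : X) : measurable_fun setT (fun z : X => z + w)%R := measurable_addr_rV2 w.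

Let intc' (w : X) : P.-integrable setT (EFin \o (fun z : X => c (z + w) * \1_S z)%R).
Proof.
have := integrable_invariant P _ _ (mtr' w)
  (lebesgue_rV2_translate mu mu_leb w) (intc w).
by congr (integrable _ _ _); apply/funext => z /=; rewrite addrK.
Qed.

Let intcE (w : X) : \int[P]_z (c z * \1_S (z - w)%R)%:E = \int[P]_z (c (z + w)%R * \1_S z)%:E.
Proof.
rewrite -(integral_invariant P _ _ (mtr' w) (lebesgue_rV2_translate mu mu_leb w) (intc w)).
by apply: eq_integral => z _ /=; rewrite addrK.
Qed.

Lemma integrable_mixed_difference u v :
  P.-integrable setT (EFin \o (fun z => mixed_difference u v z * \1_S z)%R).
Proof.
have := integrable_mixed4 P _ _ _ _ (intc' (0 : X)%R) (intc' u) (intc' v) (intc' (u + v)%R).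
congr (integrable _ _ (_ \o _)); apply/funext => z.
by rewrite /mixed_difference addr0 addrA; ring.
Qed.

(** A change of variables in each term moves the translation from the indicator to [c], so that all
    four integrals are over the same set [S]. *)
Lemma Ic_mixed_indic u v :
  Ic mu c (mixed_indic S u v) = \int[P]_z (mixed_difference u v z * \1_S z)%:E.
Proof.
rewrite /Ic -/P.
rewrite (_ : (fun z => _) = (fun z => (c z * \1_S (z - (0 : X)) - c z * \1_S (z - u)
   - c z * \1_S (z - v) + c z * \1_S (z - (u + v)))%:E)%R); last first.
  apply/funext => z; congr EFin; rewrite /mixed_indic subr0 opprD addrA; ring.
rewrite (integral_mixed4 P)//; try exact: intc.
rewrite !intcE -(integral_mixed4 P) //; try exact: intc'.
apply: eq_integral => z _; congr EFin.
by rewrite /mixed_difference addr0 addrA; ring.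
Qed.

End FixedSet.

End Perturbation.

Lemma ae_and {R : realType} {d} {T : measurableType d}
    {m : {measure set T -> \bar R}} {A B : T -> Prop} :
  {ae m, forall x, A x} -> {ae m, forall x, B x} -> {ae m, forall x, A x /\ B x}.
Proof. by move=> mA mB; near=> x; split; near: x. Unshelve. all: end_near. Qed.

(** * Two minimizers compared on a single box *)

Section Uniqueness.
Local Open Scope ereal_scope.
Context {R : realType} {d : nat} (mu : {sigma_finite_measure set 'rV[R]_d -> \bar R}).
Let P := mu \x mu.
Let X := ('rV[R]_d * 'rV[R]_d)%type.
Variables (f g : 'rV[R]_d -> R) (hbar : X -> R).
Hypothesis hbar_supp :
  exists K : set X, compact K /\ {ae mu \x mu, forall z, ~ K z -> hbar z = 0%R}.

(** The midpoint of [h1] and [h2] is at distance at least [|h1 - h2| / 2] from both constraints [0]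
    and [hbar], which leaves room for [k * phi]. *)
Lemma Gamma_bar_perturb (h1 h2 phi : X -> R) (k : R) :
  Gamma_bar mu f g hbar h1 -> Gamma_bar mu f g hbar h2 ->
  P.-integrable setT (EFin \o phi) ->
  (forall x, \int[mu]_y (phi (x, y))%:E = 0) ->
  (forall y, \int[mu]_x (phi (x, y))%:E = 0) ->
  (forall z, `|k * phi z| <= 2^-1 * `|h1 z - h2 z|)%R ->
  Gamma_bar mu f g hbar (fun z => 2^-1 * (h1 z + h2 z) + k * phi z)%R.
Proof.
move=> [[[ih1 _] h1ge h1x h1y] h1le] [[[ih2 _] h2ge h2x h2y] h2le] iphi phix phiy bnd.
have half (a : R) : 2^-1%:E * (a%:E + a%:E) + k%:E * 0 = a%:E.
  by rewrite mule0 adde0 -EFinD -EFinM; congr EFin; field.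
have range (a b e h : R) : (0 <= a -> 0 <= b -> a <= h -> b <= h ->
    `|e| <= 2^-1 * `|a - b| -> 0 <= 2^-1 * (a + b) + e <= h)%R.
  move=> a0 b0 ah bh; rewrite ler_norml => /andP[].
  by case: (leP 0 (a - b))%R => [ab|/ltW ab];
    rewrite ?(ger0_norm ab) ?(ler0_norm ab) => *; apply/andP; split; lra.
have bounds : {ae mu \x mu, forall z, (0 <= 2^-1 * (h1 z + h2 z) + k * phi z <= hbar z)%R}.
  have := ae_and (ae_and h1ge h2ge) (ae_and h1le h2le).
  by apply: filterS => z [[? ?] [? ?]]; exact: range.
split; [split|].
- split; first exact: (integrable_midpoint_perturb P _ _ _ k ih1 ih2 iphi).
  (* The perturbed density is squeezed between [0] and [hbar], so it inherits the compact set of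
     [hbar]. *)
  have [K [cK hK]] := hbar_supp; exists K; split => //.
  have := ae_and hK bounds; apply: filterS => z [hz /andP[z0 zh]] nKz.
  by apply/eqP; rewrite eq_le z0 andbT -(hz nKz).
- by apply: filterS bounds => z /andP[].
(* By Fubini almost every section is integrable, which allows the marginal to be split by
   linearity. *)
- have := ae_and (ae_and h1x h2x) (ae_and (ae_integrable1 ih1)
    (ae_and (ae_integrable1 ih2) (ae_integrable1 iphi))).
  apply: filterS => x [[e1 e2] [i1 [i2 i3]]].
  by rewrite (integral_midpoint_perturb mu _ _ _ k i1 i2 i3) e1 e2 phix half.
- have := ae_and (ae_and h1y h2y) (ae_and (ae_integrable2 ih1)
    (ae_and (ae_integrable2 ih2) (ae_integrable2 iphi))).
  apply: filterS => y [[e1 e2] [i1 [i2 i3]]].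
  by rewrite (integral_midpoint_perturb mu _ _ _ k i1 i2 i3) e1 e2 phiy half.
- by apply: filterS bounds => z /andP[].
Qed.

Variables (c : X -> R) (M : R) (U : set X).
Hypotheses (mu_leb : is_lebesgue_rV mu) (mc : measurable_fun setT c)
  (cM : forall z, (`|c z| <= M)%R) (cC2 : C2_on U c).

Lemma Ic_midpoint_perturb (h1 h2 phi : X -> R) (k : R) :
  P.-integrable setT (EFin \o h1) -> P.-integrable setT (EFin \o h2) ->
  P.-integrable setT (EFin \o phi) ->
  Ic mu c (fun z => 2^-1 * (h1 z + h2 z) + k * phi z)%R =
  2^-1%:E * (Ic mu c h1 + Ic mu c h2) + k%:E * Ic mu c phi.
Proof.
move=> i1 i2 i3; rewrite /Ic -integral_midpoint_perturb.
- by apply: eq_integral => z _; congr EFin; ring.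
- exact: (integrable_bounded_mul P c h1 M).
- exact: (integrable_bounded_mul P c h2 M).
- exact: (integrable_bounded_mul P c phi M).
Qed.

Lemma rVbox_segment (a b x w : 'rV[R]_d) (s t : R) : (0 <= s <= t)%R ->
  rVbox a b x -> rVbox a b (x + t *: w)%R -> rVbox a b (x + s *: w)%R.
Proof.
move=> /andP[s0 st] bx bt i; have := bx i; have := bt i; rewrite !mxE.
move=> /andP[h1 h2] /andP[h3 h4].
have [w0|/ltW w0] := leP 0%R (w ord0 i).
  have p1 := mulr_ge0 s0 w0; have p2 := ler_wpM2r w0 st.
  by move: p1 p2 h1 h2; move: (s * _)%R (t * _)%R => p q *; apply/andP; split; lra.
have p1 := mulr_ge0_le0 s0 w0; have p2 := ler_wnM2r w0 st.
by move: p1 p2 h1 h2; move: (s * _)%R (t * _)%R => p q *; apply/andP; split; lra.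
Qed.

(** As [u] moves only [x] and [v] only [y], two opposite corners in the product box [B] force the
    whole rectangle into [B]. The intermediate point of the mean value theorem then lies where the
    sign is known. *)
Lemma mixed_difference_sign (a b a' b' : 'rV[R]_d) (i j : 'I_d) (s t r : R) (z : X) :
  let B := rVbox a b `*` rVbox a' b' in
  let u := t *: @dirx R d i in let v := r *: @diry R d j in
  B `<=` U -> (forall z, B z -> 0 < s * Dxy c z i j)%R -> (0 < t)%R -> (0 < r)%R ->
  B z -> B (z + u + v)%R ->
  (0 < s * (c z - c (z + u) - c (z + v) + c (z + u + v)))%R.
Proof.
move=> B u v BU Bs t0 r0 Bz Bzuv.
have rect (p q : R) : (0 <= p <= t)%R -> (0 <= q <= r)%R ->
    B (Defs.shift (Defs.shift z p (dirx R i)) q (diry R j)).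
  move=> pt qr; have [z1 z2] := Bz.
  have [w1 w2] := Bzuv; move: w1 w2; rewrite /= !scaler0 !addr0 => w1 w2.
  by split; rewrite /= scaler0 addr0; [exact: rVbox_segment pt z1 w1|exact: rVbox_segment qr z2 w2].
have [|||p [q [pt qr]]] := @mixed_difference_MVT R d c (dirx R i) (diry R j) U z t r cC2 _ _ t0 r0.
- by exists i; left.
- by exists j; right.
- by move=> p q pt qr; apply: BU; exact: rect.
have -> : Defs.shift (Defs.shift z t (dirx R i)) r (diry R j) = (z + u + v)%R by [].
have -> : Defs.shift z t (dirx R i) = (z + u)%R by [].
have -> : Defs.shift z r (diry R j) = (z + v)%R by [].
move=> E.
have -> : (c z - c (z + u) - c (z + v) + c (z + u + v) =
  c (z + u + v) - c (z + u) - c (z + v) + c z)%R by ring.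
rewrite E !mulrA (pmulr_lgt0 _ r0) (pmulr_lgt0 _ t0).
by have := Bs _ (rect p q pt qr); rewrite /Dxy mxE.
Qed.

(** Otherwise a perturbation supported where the gap is at least [del] makes the midpoint cheaper
    than the average of two minimal costs. The boolean [n], read as an exponent, encodes the sign of
    the mixed derivative. *)
Lemma minimizers_gap_null (h1 h2 : X -> R) (a b a' b' : 'rV[R]_d) (i j : 'I_d)
    (n : bool) (del : R) :
  let B := rVbox a b `*` rVbox a' b' in
  is_minimizer mu c (Gamma_bar mu f g hbar) h1 ->
  is_minimizer mu c (Gamma_bar mu f g hbar) h2 ->
  B `<=` U -> (forall z, B z -> 0 < (-1) ^+ n * Dxy c z i j)%R -> (0 < del)%R ->
  P.-negligible (B `&` [set z | del <= `|h1 z - h2 z|]%R).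
Proof.
move=> B [G1 min1] [G2 min2] BU Bs del0.
have [[[ih1 _] _ _ _] _] := G1; have [[[ih2 _] _ _ _] _] := G2.
have mh1 : measurable_fun setT h1 by apply/measurable_EFinP; exact: measurable_int ih1.
have mh2 : measurable_fun setT h2 by apply/measurable_EFinP; exact: measurable_int ih2.
set E := _ `&` _.
have mE : measurable E.
  apply: measurableI; first by apply: measurableX; exact: measurable_rVbox.
  rewrite (_ : [set z | _] = (fun z => `|h1 z - h2 z|%R) @^-1` `[del, +oo[%classic).
    rewrite -[X in measurable X]setTI.
    by apply: (measurableT_comp _ (measurable_funB mh1 mh2)).
  by apply/seteqP; split => z /=; rewrite in_itv /= andbT.
apply/negligibleP => //; apply/eqP; rewrite eq_le measure_ge0 andbT leNgt.
apply/negP => PE.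
have mT (v : X) A : measurable A -> measurable ((fun z : X => z + v)%R @^-1` A).
  by move=> mA; rewrite -[X in measurable X]setTI; exact: measurable_addr_rV2.
have EB : E `<=` B by move=> z [].
(* Two successive overlaps, first along [x_i] for [E], then along [y_j] for the resulting [E'], put
   all four corners of the rectangle in [E]. *)
have [t [t0 PE']] := translate_overlap mu mu_leb E (dirx R i) a b a' b' mE PE EB.
set u := (t *: dirx R i)%R in PE'; set E' := _ `&` _ in PE'.
have mE' : measurable E' by apply: measurableI => //; exact: mT.
have E'B : E' `<=` B by move=> z [/EB].
have [r [r0 PS]] := translate_overlap mu mu_leb E' (diry R j) a b a' b' mE' PE' E'B.
set v := (r *: diry R j)%R in PS; set S := _ `&` _ in PS.
have mS : measurable S by apply: measurableI => //; exact: mT.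
have SB : S `<=` B by move=> z [/E'B].
pose phi := mixed_indic S u v.
have uE : u = ((t *: delta_mx ord0 i)%R, 0%R) by rewrite /u; congr pair; exact: scaler0.
have vE : v = (0%R, (r *: delta_mx ord0 j)%R) by rewrite /v; congr pair; exact: scaler0.
have iphi : P.-integrable setT (EFin \o phi).
  exact: (integrable_mixed_indic mu mu_leb S a b a' b').
have suppE z : phi z != 0%R -> E z.
  move=> /mixed_indic_support[[[]//]|[[_ h] _]|[_ [h _]]|[_ [_ h]]]; move: h => /=.
  - by rewrite subrK.
  - by rewrite subrK.
  - by rewrite subrK subrK.
(* The sign makes [k * Ic phi] negative. Since [|phi| <= 4], the factor [1/8] gives
   [|k phi| <= del / 2], hence at most half the gap on [E]. *)
pose k : R := (- ((-1) ^+ n * (del / 8)))%R.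
have kE : `|k|%R = (del / 8)%R.
  by rewrite normrN normrM normr_sign mul1r ger0_norm// divr_ge0// ltW.
have G0 : Gamma_bar mu f g hbar (fun z => 2^-1 * (h1 z + h2 z) + k * phi z)%R.
  apply: Gamma_bar_perturb => //.
  - by move=> x; rewrite /phi uE vE; exact: (integral_mixed_indic_y mu mu_leb S a b a' b').
  - by move=> y; rewrite /phi uE vE; exact: (integral_mixed_indic_x mu mu_leb S a b a' b').
  - move=> z; have [->|/suppE [_ /= dz]] := eqVneq (phi z) 0%R.
      by rewrite mulr0 normr0 mulr_ge0.
    rewrite normrM kE.
    have := mixed_indic_abs_le4 S u v z; rewrite -/(phi z).
    move: dz del0; move: `|_|%R `|_|%R => p q *; nra.
have icphi : 0 < ((-1) ^+ n)%:E * Ic mu c phi.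
  rewrite (Ic_mixed_indic mu mu_leb S a b a' b' mS SB c M mc cM).
  have iD := integrable_mixed_difference mu mu_leb S a b a' b' mS SB c M mc cM u v.
  rewrite -(integralZl measurableT iD).
  have pos z : S z -> (0 < (-1) ^+ n * (c z - c (z + u) - c (z + v) + c (z + u + v)))%R.
    move=> Sz; apply: (mixed_difference_sign a b a' b') => //; first exact: SB.
    by rewrite addrAC; apply: EB; have [_ []] := Sz.
  apply: (integral_gt0 P (fun z => (-1) ^+ n * ((c z - c (z + u) - c (z + v) +
      c (z + u + v)) * \1_S z))%R S) => //.
  - exact: (integrableZl measurableT _ iD).
  - move=> z; rewrite indicE; have [/set_mem/pos|_] := boolP (z \in S).
      by rewrite mulr1; exact: ltW.
    by rewrite !mulr0.
  - by move=> z Sz; rewrite indicE mem_set// mulr1; exact: pos.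
have fin h : P.-integrable setT (EFin \o h) -> Ic mu c h \is a fin_num.
  move=> ih; apply: (integrable_fin_num measurableT).
  exact: (integrable_bounded_mul P c h M).
(* Adding the two inequalities cancels the costs of [h1] and [h2] and leaves [0 <= 2 k Ic phi],
   contrary to the choice of the sign of [k]. *)
have := min1 _ G0; have := min2 _ G0.
rewrite Ic_midpoint_perturb//.
move: icphi; rewrite -(fineK (fin _ ih1)) -(fineK (fin _ ih2)) -(fineK (fin _ iphi)).
rewrite -!(EFinM, EFinD) lte_fin !lee_fin /k.
move: (fine _) (fine _) (fine _) => p q s.
rewrite mulNr mulrAC; move: (_ * s)%R => y y0 e1 e2.
have := mulr_gt0 y0 del0; lra.
Qed.

End Uniqueness.

(** * Dimension zero: a single point of mass one, the empty product *)

Lemma lebesgue_rV_dim0 (R : realType) (mu : {measure set 'rV[R]_0 -> \bar R}) :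
  is_lebesgue_rV mu -> mu setT = 1%E.
Proof.
move=> mu_leb; have := mu_leb 0 0 (fun i => ltac:(by case: i)).
rewrite big_ord0 => <-; congr (mu _).
by apply/seteqP; split => // x _ [].
Qed.

Lemma ae_and_witness_dim0 (R : realType) (mu : {measure set 'rV[R]_0 -> \bar R})
    (A B : 'rV[R]_0 -> Prop) : is_lebesgue_rV mu ->
  {ae mu, forall x, A x} -> {ae mu, forall x, B x} -> exists x, A x /\ B x.
Proof.
move=> mu_leb hA hB.
apply: contrapT => no.
have [N [mN N0 sub]] := ae_and hA hB.
have NT : N = setT.
  by apply/seteqP; split => // x _; apply: sub => /= AB; apply: no; exists x.
by move: N0; rewrite NT (lebesgue_rV_dim0 _ _ mu_leb) => /eqP; rewrite onee_eq0.
Qed.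

(** Integrating over a point of mass one is evaluation, so the first marginal condition already
    fixes the only value of the density. *)
Lemma Gamma_unique_dim0 (R : realType) (mu : {sigma_finite_measure set 'rV[R]_0 -> \bar R})
    (f g : 'rV[R]_0 -> R) (h1 h2 : 'rV[R]_0 * 'rV[R]_0 -> R) :
  is_lebesgue_rV mu -> Gamma mu f g h1 -> Gamma mu f g h2 -> h1 = h2.
Proof.
move=> mu_leb [_ _ h1x _] [_ _ h2x _].
have eq0 (x y : 'rV[R]_0) : x = y by apply/rowP => -[].
have int1 (h : 'rV[R]_0 * 'rV[R]_0 -> R) (x : 'rV[R]_0) :
    (\int[mu]_y (h (x, y))%:E)%E = (h (0, 0))%:E.
  rewrite (_ : (fun y => _) = cst (h (0, 0))%:E); last first.
    by apply/funext => y; rewrite (eq0 x 0) (eq0 y 0).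
  by rewrite integral_cst// [X in (_ * X)%E](lebesgue_rV_dim0 _ _ mu_leb) mule1.
have [x []] := ae_and_witness_dim0 _ _ _ _ mu_leb h1x h2x.
rewrite !int1 => -[E1] [E2]; apply/funext => -[a b].
by rewrite (eq0 a 0) (eq0 b 0) E1 E2.
Qed.

(** * From single boxes to the whole space by a countable cover *)

Theorem theorem8p1 (R : realType) (d : nat)
    (mu : {sigma_finite_measure set 'rV[R]_d -> \bar R})
    (c : 'rV[R]_d * 'rV[R]_d -> R) (Z : set ('rV[R]_d * 'rV[R]_d))
    (hbar : 'rV[R]_d * 'rV[R]_d -> R) (f g : 'rV[R]_d -> R) :
  is_lebesgue_rV mu ->
  (* c continuous and (C1)-(C3) *)
  continuous c ->
  (exists M : R, forall z, `|c z| <= M) ->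
  closed Z -> (mu \x mu)%E.-negligible Z -> C2_on (~` Z) c ->
  (forall z, ~ Z z -> \det (Dxy c z) != 0) ->
  (* 0 <= hbar in L^oo with compact support *)
  measurable_fun setT hbar ->
  {ae (mu \x mu)%E, forall z, 0 <= hbar z} ->
  (exists M : R, {ae (mu \x mu)%E, forall z, `|hbar z| <= M}) ->
  (exists K : set ('rV[R]_d * 'rV[R]_d),
      compact K /\ {ae (mu \x mu)%E, forall z, ~ K z -> hbar z = 0}) ->
  (* 0 <= f, g in L^1_c *)
  L1c_d mu f -> {ae mu, forall x, 0 <= f x} ->
  L1c_d mu g -> {ae mu, forall y, 0 <= g y} ->
  (exists h, Gamma_bar mu f g hbar h) ->
  forall h1 h2,
    is_minimizer mu c (Gamma_bar mu f g hbar) h1 ->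
    is_minimizer mu c (Gamma_bar mu f g hbar) h2 ->
    {ae (mu \x mu)%E, forall z, h1 z = h2 z}.
Proof.
move=> mu_leb cc [M cM] Zcl Z0 cC2 cdet _ _ _ hsupp _ _ _ _ _ h1 h2 min1 min2.
case: d => [|d'] in mu c Z hbar f g mu_leb cc cM Zcl Z0 cC2 cdet hsupp h1 h2 min1 min2 *.
  apply: aeW => z; have [[G1 _] _] := min1; have [[G2 _] _] := min2.
  by rewrite (Gamma_unique_dim0 _ _ _ _ _ _ mu_leb G1 G2).
have mc := continuous_measurable_rV2 _ cc.
pose good k i j (b : bool) := @ratcube2 R d'.+1 k `<=` ~` Z /\
  forall z, ratcube2 k z -> 0 < (-1) ^+ b * Dxy c z i j.
(* An index records a rational cube, an entry of the mixed Hessian, its sign, and a threshold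
   [1/(n+1)] for the gap. This type is countable, so the null sets found on the cubes have a null
   union. *)
pose T := ((('rV[rat]_d'.+1 * nat) * ('rV[rat]_d'.+1 * nat)) * ('I_d'.+1 * 'I_d'.+1 * bool) * nat)%type.
pose F (k : T) := if `[< good k.1.1 k.1.2.1.1 k.1.2.1.2 k.1.2.2 >]
  then ratcube2 k.1.1 `&` [set z | k.2.+1%:R^-1 <= `|h1 z - h2 z|] else set0.
apply: (@negligibleS _ _ _ _ (Z `|` \bigcup_k F k)); last first.
  apply: negligibleU => //; apply: negligible_bigcup_countType => -[[k [[i j] b]] n].
  rewrite /F /=; case: asboolP => [[kZ kpos]|_]; last exact: negligible_set0.
  apply: (minimizers_gap_null _ _ _ _ hsupp c M (~` Z) mu_leb mc cM cC2 h1 h2 _ _ _ _ i j b _ min1 min2 kZ kpos).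
  by rewrite invr_gt0.
move=> z /= hz; have [Zz|nZz] := pselect (Z z); [by left|right].
(* The dimension is now positive, so the zero matrix has determinant 0. *)
have [i [j Dij]] : exists i j, Dxy c z i j != 0.
  apply: contrapT => no; have := cdet z nZz; rewrite (_ : Dxy c z = 0).
    by rewrite det0 eqxx.
  apply/matrixP => i j; rewrite [RHS]mxE; apply: contrapT => /eqP Dij.
  by apply: no; exists i, j.
pose b := Dxy c z i j < 0.
have bpos : 0 < (-1) ^+ b * Dxy c z i j.
  rewrite /b; have [h|h] := ltP (Dxy c z i j) 0.
    by rewrite expr1 mulN1r oppr_gt0.
  by rewrite expr0 mul1r lt_neqAle eq_sym Dij.
have Dcont : {for z, continuous (fun w => (-1) ^+ b * Dxy c w i j)}.
  (* The directions come in the order in which [Dxy] differentiates, first [y_j] and then [x_i]. *)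
  have [_ _ _ _ h] := cC2 z nZz (diry R j) (dirx R i) (ex_intro _ j (or_intror erefl)) (ex_intro _ i (or_introl erefl)).
  rewrite (_ : (fun w => _) = fun w => (-1) ^+ b * pdiff (pdiff c (diry R j)) (dirx R i) w); last first.
    by apply/funext => w; rewrite /Dxy mxE.
  by apply: cvgMr; exact: h.
have nb : nbhs z (~` Z `&` [set w | 0 < (-1) ^+ b * Dxy c w i j]).
  apply: filterI; first by move: Zcl; rewrite -openC openE; exact.
  exact: (cvgr_gt _ Dcont _ bpos).
have [k [kz ksub]] := ratcube2_nbhs _ _ nb.
have h12 : 0 < `|h1 z - h2 z| by rewrite normr_gt0 subr_eq0; apply/eqP.
(* With this choice [1/(n+1)] is at most the gap at [z]. *)
pose n := Num.bound `|h1 z - h2 z|^-1.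
exists (k, ((i, j), b), n) => //; rewrite /F /= asboolT; last first.
  by split => w /ksub [].
split => //=; rewrite -[leRHS]invrK lef_pV2 ?posrE ?invr_gt0//.
apply: ltW; apply: lt_le_trans (archi_boundP _) _; first by rewrite invr_ge0.
by rewrite ler_nat.
Qed.
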